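(* Let $\alpha\in\mathbb{D}$, $\beta\in\mathbb{T}$, $\beta\neq1$, $\Psi_\alpha(z)=\frac{\alpha-z}{1-\overline{\alpha}z}$, $r_\beta(z)=\beta z$, $\varphi=\Psi_\alpha\circ r_\beta\circ\Psi_\alpha$, let $m\in\mathrm{Hol}(\mathbb{D})$, $m\not\equiv0$, and $T:\mathrm{Hol}(\mathbb{D})\to\mathrm{Hol}(\mathbb{D})$, $Tf=m\cdot(f\circ\varphi)$. If $m(z_0)=0$ for some $z_0\in\mathbb{D}$, then $\sigma_p(T)=\emptyset$ (whether $\varphi$ is periodic or aperiodic).
   Context: $\mathbb{D}$ is the open unit disc, $\mathbb{T}$ the unit circle, $\mathrm{Hol}(\mathbb{D})$ the space of holomorphic functions on $\mathbb{D}$. $\sigma_p(T)$ is the set of $\lambda\in\mathbb{C}$ such that $\lambda\mathrm{Id}-T$ is not injective. *)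

(* Defs.v *)
(* complex numbers are R[i] (mathcomp-real-closed)
   over an arbitrary R : realType, viewed as a normed module over itself
   via the regular-algebra alias R[i]^o.  Complex differentiability
   (holomorphy) is MathComp-Analysis' [derivable f z 1] for scalars in R[i]. *)
From HB Require Import structures.
From mathcomp Require Import all_boot all_order all_algebra.
From mathcomp Require Import all_classical all_reals all_analysis.
From mathcomp Require Import complex.
Import Order.TTheory GRing.Theory Num.Theory.
Set Implicit Arguments. Unset Strict Implicit. Unset Printing Implicit Defensive.
Local Open Scope ring_scope.
Local Open Scope classical_set_scope.

Notation Cplx R := ((R[i])^o).

Definition disc (R : realType) : set (Cplx R) := [set z | `|z| < 1].
Arguments disc R : clear implicits.

(* f is holomorphic on D: complex differentiable at every point of D.
   Elements of Hol(D) are represented by functions C -> C; only their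
   values on D matter. *)
Definition holo_disc (R : realType) (f : Cplx R -> Cplx R) : Prop :=
  forall z, z \in disc R -> derivable f z 1.

Definition Psi (R : realType) (a z : Cplx R) : Cplx R :=
  (a - z) / (1 - a^* * z).

Definition rot (R : realType) (b z : Cplx R) : Cplx R := b * z.

Definition phi_ab (R : realType) (a b : Cplx R) : Cplx R -> Cplx R :=
  Psi a \o rot b \o Psi a.

Definition wcomp (R : realType) (m phi : Cplx R -> Cplx R)
  (f : Cplx R -> Cplx R) : Cplx R -> Cplx R :=
  fun z => m z * f (phi z).

(* point spectrum of T : Hol(D) -> Hol(D): the lambda such that
   lambda Id - T is not injective on Hol(D) (two elements of Hol(D) are
   equal iff they agree on D). *)
Definition point_spectrum (R : realType)
  (T : (Cplx R -> Cplx R) -> (Cplx R -> Cplx R)) : set (Cplx R) :=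
  [set lam | exists f g : Cplx R -> Cplx R,
     [/\ holo_disc f, holo_disc g,
         (exists2 z, z \in disc R & f z != g z) &
         forall z, z \in disc R -> lam * f z - T f z = lam * g z - T g z]].

(* Main.v *)
(* Write h = f - g and conjugate by Psi_alpha, so that phi becomes the rotation
   by beta and lam h(z) = m(z) h(beta z).  Suppose first lam != 0 and m(w) = 0.
   After rescaling, everything is differentiable on the closed unit disc.
   Iterating n times, h^2 is divisible by prod_(j < n) B(beta^j z), where
   B = Psi_w is the Blaschke factor vanishing at w: the quotient is
   lam^(-2n) prod_j (m^2 / B)(beta^j z) h(beta^n z)^2.  As |B| = 1 on the unit
   circle, the maximum principle bounds the quotient by max |h|^2 independently
   of n, while prod_j |B(beta^j p)| <= rho^n with rho < 1; hence h(p) = 0.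
   No distinction between periodic and aperiodic beta is needed.  If lam = 0,
   then h(beta z) vanishes near a point w with m(w) != 0, hence is divisible by
   all powers of Psi_w, and the same estimate applies.

   The maximum principle is obtained without integrals: a discrete Goursat
   argument shows that left Riemann sums over dyadic subdivisions of the boundary
   of a square get arbitrarily small; applied to g(e^(s+it)) on
   [-T, 0] x [0, 2 pi] this yields |g(0)| <= max_(|z| = 1) |g|, and other
   interior points follow by composing with Psi. *)
Require Import Defs.
From HB Require Import structures.
From mathcomp Require Import all_boot all_order all_algebra.
From mathcomp Require Import all_classical all_reals all_analysis.
From mathcomp Require Import complex ring lra.
Import Order.TTheory GRing.Theory Num.Theory.
Local Open Scope ring_scope.
Local Open Scope classical_set_scope.
Import numFieldNormedType.Exports. Import Normc ComplexField.
Set Implicit Arguments. Unset Strict Implicit. Unset Printing Implicit Defensive.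

(** * Derivatives over a scalar field *)

Section DerivableScalar.
Variable K : numFieldType.
Implicit Types (f g : K^o -> K^o) (z : K^o).

Lemma derivable1_comp f g z :
  derivable f z 1 -> derivable g (f z) 1 -> derivable (g \o f) z 1.
Proof.
move=> /derivable1_diffP hf /derivable1_diffP hg.
by apply/derivable1_diffP; apply: differentiable_comp.
Qed.

Lemma derivable1_mul f g z :
  derivable f z 1 -> derivable g z 1 -> derivable (fun x => f x * g x) z 1.
Proof. by move=> df dg; exact: derivableM. Qed.

Lemma derivable1_exp f n z :
  derivable f z 1 -> derivable (fun x => f x ^+ n) z 1.
Proof.
move=> df; elim: n => [|n IHn].
  by under eq_fun do rewrite expr0; exact: derivable_cst.
by under eq_fun do rewrite exprS; exact: derivable1_mul.
Qed.

Lemma derivable1_prod (I : Type) (r : seq I) (f : I -> K^o -> K^o) z :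
  (forall i, derivable (f i) z 1) ->
  derivable (fun x => \prod_(i <- r) f i x) z 1.
Proof.
move=> df; elim: r => [|i r IHr].
  by under eq_fun do rewrite big_nil; exact: derivable_cst.
by under eq_fun do rewrite big_cons; exact: derivable1_mul.
Qed.

Lemma derivable1_div f g z :
  derivable f z 1 -> derivable g z 1 -> g z != 0 ->
  derivable (fun x => f x / g x) z 1.
Proof. by move=> df dg gz; apply: derivable1_mul => //; exact: derivableV. Qed.

Lemma derivable1_lin (b z : K^o) : derivable (fun x : K^o => b * x : K^o) z 1.
Proof. by apply: derivable1_mul; [exact: derivable_cst | exact: derivable_id]. Qed.

Lemma derivable1_affine (a c z : K^o) :
  derivable (fun x : K^o => a - c * x : K^o) z 1.
Proof. exact: derivableB. Qed.

Lemma derivable1_moebius (a c z : K^o) :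
  1 - c * z != 0 -> derivable (fun x : K^o => (a - x) / (1 - c * x) : K^o) z 1.
Proof. by move=> cz; exact: derivable1_div. Qed.

Lemma derivable1_eq_nbhs f g z d : 0 < d ->
  (forall w, `|w - z| < d -> f w = g w) -> derivable f z 1 -> derivable g z 1.
Proof.
move=> d0 fg; apply: near_eq_derivable; apply/nbhs_ballP; exists d => // w; rewrite -ball_normE /= distrC; exact: fg.
Qed.

(* At [z] the junk value [x / 0 = 0] is also the right one. *)
Lemma derivable1_sq_div f z : derivable f z 1 -> f z = 0 ->
  derivable (fun x => f x ^+ 2 / (z - x)) z 1.
Proof.
move=> df fz0; move: (df); rewrite /derivable => /cvg_ex[l hl].
(* Since [f z = 0], the difference quotient of [f x ^+ 2 / (z - x)] at [z] is minus the square of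
   that of [f]. *)
apply/cvg_ex; exists (- (l * l)).
apply: cvg_trans (cvgN (cvgM hl hl)); apply: near_eq_cvg; near=> h.
have h0 : h != 0 by near: h; exact: nbhs_dnbhs_neq.
rewrite /= fz0 /GRing.scale /= subrr invr0 mulr0 !subr0 mulr1 opprD addrCA subrr addr0.
by rewrite fctE /= mulr1 subr0; field.
Unshelve. all: by end_near. Qed.

(** Limit-free form of the derivative; the weak inequality lets it include [w = z], where both sides
    vanish. *)
Lemma is_derive1_eps f z D : is_derive z 1 f D -> forall e, 0 < e ->
  exists2 d, 0 < d & forall w, `|w - z| < d ->
    `|f w - f z - D * (w - z)| <= e * `|w - z|.
Proof.
move=> [df <-] e e0.
have /cvgrPdist_le/(_ e e0) := df; rewrite /dnbhs/= => /nbhs_ballP[d /= d0 hd].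
exists d => // w wd; have [->|wz] := eqVneq w z.
  by rewrite !subrr mulr0 subr0 normr0 mulr0.
have wz0 : w - z != 0 by rewrite subr_eq0.
have := hd (w - z); rewrite -ball_normE /= sub0r normrN => /(_ wd wz0).
rewrite /GRing.scale /= mulr1 subrK -/('D_1 f z) => h.
have -> : f w - f z - 'D_1 f z * (w - z)
    = - (('D_1 f z - (w - z)^-1 * (f w - f z)) * (w - z)).
  by field.
by rewrite normrN normrM ler_wpM2r.
Qed.

End DerivableScalar.

(** * Bisection of the unit square *)

Section Bisection.
Variable R : realType.
Implicit Types x y l u v : R.

Lemma nested_intervals (x l : nat -> R) :
  (forall k, 0 <= l k) -> (forall k, x k <= x k.+1) ->
  (forall k, x k.+1 + l k.+1 <= x k + l k) ->
  exists u, forall k, x k <= u <= x k + l k.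
Proof.
move=> l0 xS xlS.
have xmon i j : x i <= x (i + j)%N.
  by elim: j => [|j IHj]; rewrite ?addn0 // addnS; exact: le_trans IHj (xS _).
have xlmon i j : x (i + j)%N + l (i + j)%N <= x i + l i.
  by elim: j => [|j IHj]; rewrite ?addn0 // addnS; exact: le_trans (xlS _) IHj.
have xxl i j : x i <= x j + l j.
  case: (leqP i j) => [/subnKC ij|/ltnW/subnKC ij].
    by have := xmon i (j - i)%N; have := l0 j; rewrite ij; lra.
  by have := xlmon j (i - j)%N; have := l0 i; rewrite ij; lra.
(* By [xxl] every right endpoint is an upper bound of all left endpoints, so their supremum lies in
   every interval. *)
exists (sup (range x)) => k; apply/andP; split.
  apply: ub_le_sup; last by exists k.
  by exists (x 0%N + l 0%N) => _ [i _ <-].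
by apply: ge_sup; [exists (x 0%N), 0%N | move=> _ [i _ <-]].
Qed.

(** Compactness of the unit square as an induction principle: a failing square has a failing
    quarter, and the resulting nested squares close in on a point where the local hypothesis is
    contradicted. It serves both the Goursat argument and boundedness on the closed disc. *)
Lemma square_bisection (P : R -> R -> R -> Prop) :
  (forall x y l, P x y (l / 2) -> P (x + l / 2) y (l / 2) ->
     P x (y + l / 2) (l / 2) -> P (x + l / 2) (y + l / 2) (l / 2) -> P x y l) ->
  (forall u v, exists2 d, 0 < d & forall x y l, 0 <= l < d ->
     0 <= x -> x + l <= 1 -> 0 <= y -> y + l <= 1 ->
     x <= u <= x + l -> y <= v <= y + l -> P x y l) ->
  P 0 0 1.
Proof.
move=> Psub Ploc; apply: contrapT => nP.
(* Failure of the quarter is stated as an implication, so that a candidate exists for every square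
   and [choice] gives a total function. *)
have step (c : R * R * R) : exists c' : R * R,
    [/\ c'.1 = c.1.1 \/ c'.1 = c.1.1 + c.2 / 2,
        c'.2 = c.1.2 \/ c'.2 = c.1.2 + c.2 / 2 &
        ~ P c.1.1 c.1.2 c.2 -> ~ P c'.1 c'.2 (c.2 / 2)].
  case: c => [[x y] l] /=.
  have [p1|n1] := pselect (P x y (l / 2)); last by exists (x, y); split; auto.
  have [p2|n2] := pselect (P (x + l / 2) y (l / 2)).
    have [p3|n3] := pselect (P x (y + l / 2) (l / 2)).
      by exists (x + l / 2, y + l / 2); split; auto => n p; apply: n; exact: Psub.
    by exists (x, y + l / 2); split; auto.
  by exists (x + l / 2, y); split; auto.
have [s sP] := choice step.
pose l k : R := 2^-1 ^+ k.
pose c := fix c k := if k is k'.+1 then s (c k', l k') else (0, 0) : R * R.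
have cP k : ~ P (c k).1 (c k).2 (l k).
  elim: k => [|k IHk]; first by rewrite /l expr0.
  have [_ _ /(_ IHk)] := sP (c k, l k).
  by rewrite /= /l exprSr.
have l_ge0 k : 0 <= l k by rewrite exprn_ge0 // invr_ge0.
have lS k : l k.+1 = l k / 2 by rewrite /l exprSr.
have cx k : (c k).1 <= (c k.+1).1 /\ (c k.+1).1 + l k.+1 <= (c k).1 + l k.
  have := l_ge0 k; rewrite lS.
  by case: (sP (c k, l k)) => /= -[->|->] _ _; split; lra.
have cy k : (c k).2 <= (c k.+1).2 /\ (c k.+1).2 + l k.+1 <= (c k).2 + l k.
  have := l_ge0 k; rewrite lS.
  by case: (sP (c k, l k)) => /= _ [->|->] _; split; lra.
have [u uP] := @nested_intervals (fun k => (c k).1) l l_ge0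
  (fun k => (cx k).1) (fun k => (cx k).2).
have [v vP] := @nested_intervals (fun k => (c k).2) l l_ge0
  (fun k => (cy k).1) (fun k => (cy k).2).
have [d d0 dP] := Ploc u v.
have cge k : [/\ 0 <= (c k).1, (c k).1 + l k <= 1, 0 <= (c k).2 & (c k).2 + l k <= 1].
  elim: k => [|k [h1 h2 h3 h4]]; first by rewrite /= /l expr0 add0r.
  by have [? ?] := cx k; have [? ?] := cy k; split; lra.
have [k kd] : exists k, l k < d.
  have /cvgrPdist_lt/(_ d d0)[k _ /(_ k (leqnn k))] :=
    @cvg_expr R 2^-1 (ltac:(by rewrite ger0_norm ?invr_ge0 // invf_lt1 ?ltr1n)).
  by rewrite sub0r normrN ger0_norm ?l_ge0 //; exists k.
have [? ? ? ?] := cge k.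
by apply: (cP k); apply: dP => //; rewrite l_ge0.
Qed.

End Bisection.

(** * Complex modulus and exponential *)

Section ComplexNorm.
Variable R : realType.
Local Notation C := (Cplx R).
Implicit Types (z w : C) (s t : R).

Lemma normrE z : `|z| = ((normc z)%:C%C : C). Proof. by []. Qed.

Lemma normc_ge0 z : 0 <= normc z.
Proof. by case: z => a b; exact: sqrtr_ge0. Qed.

Lemma normc_lt1 z : (`|z| < 1) = (normc z < 1).
Proof. exact: (ltcR (normc z) 1). Qed.

Lemma normc_real t : normc (t%:C%C : C) = `|t|.
Proof. by rewrite /= expr0n addr0 sqrtr_sqr. Qed.

Lemma normc_le_ReIm z : normc z <= `|complex.Re z| + `|complex.Im z|.
Proof.
case: z => a b /=; rewrite -(ger0_norm (addr_ge0 (normr_ge0 a) (normr_ge0 b))).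
rewrite -sqrtr_sqr ler_sqrt ?sqr_ge0 // sqrrD !real_normK ?num_real //.
by have := mulr_ge0 (normr_ge0 a) (normr_ge0 b); lra.
Qed.

Lemma normcB_le z w : normc (z - w) <= normc z + normc w.
Proof. by rewrite -(normcN w); exact: le_normcD. Qed.

Lemma le_normc_sum (I : Type) (r : seq I) (F : I -> C) (G : I -> R) :
  (forall i, normc (F i) <= G i) ->
  normc (\sum_(i <- r) F i) <= \sum_(i <- r) G i.
Proof.
move=> FG; elim: r => [|i r IHr]; first by rewrite !big_nil normc0.
by rewrite !big_cons (le_trans (le_normcD _ _)) // lerD.
Qed.

Lemma normc_prod (I : Type) (r : seq I) (F : I -> C) :
  normc (\prod_(i <- r) F i) = \prod_(i <- r) normc (F i).
Proof.
elim: r => [|i r IHr]; first by rewrite !big_nil normc1.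
by rewrite !big_cons normcM IHr.
Qed.

Lemma normc_conj z : normc (z^*) = normc z.
Proof. by case: z => x y /=; rewrite sqrrN. Qed.

Lemma normcX z n : normc (z ^+ n) = normc z ^+ n.
Proof.
elim: n => [|n IHn]; first by rewrite !expr0 normc1.
by rewrite !exprS normcM IHn.
Qed.

Lemma derivable_normc (f : C -> C) z : derivable f z 1 ->
  exists D, forall e, 0 < e -> exists2 d, 0 < d & forall w, normc (w - z) < d ->
    normc (f w - f z - D * (w - z)) <= e * normc (w - z).
Proof.
move=> /derivableP df; exists ('D_1 f z) => e e0.
have [|d d0 hd] := @is_derive1_eps (R[i]) f z _ df (e%:C)%C; first by rewrite ltcR.
have dR : ((complex.Re d)%:C)%C = d by rewrite RRe_real // gtr0_real.
exists (complex.Re d) => [|w wd]; first by rewrite -dR ltcR in d0.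
have := hd w; rewrite !normrE -dR ltcR -rmorphM /= lecR; exact.
Qed.

Lemma derivable_normc_continuous (f : C -> C) z : derivable f z 1 ->
  forall e, 0 < e -> exists2 d, 0 < d &
    forall w, normc (w - z) < d -> normc (f w - f z) <= e.
Proof.
move=> /derivable_normc[D hD] e e0; have [d d0 hd] := hD 1 ltr01.
have D0 := normc_ge0 D.
have D1 : 0 < normc D + 1 by lra.
exists (Num.min d (e / (normc D + 1))) => [|w].
  by rewrite lt_min d0 divr_gt0.
rewrite lt_min => /andP[/hd h wd].
rewrite -(subrK (D * (w - z)) (f w - f z)) (le_trans (le_normcD _ _)) //.
move: wd; rewrite ltr_pdivlMr // normcM => wd.
lra.
Qed.

End ComplexNorm.

Section Exponential.
Variable R : realType.
Local Notation C := (Cplx R).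
Implicit Types s t : R.

Definition expC s t : C := Complex (expR s * cos t) (expR s * sin t).

Lemma expCD s t s' t' : expC (s + s') (t + t') = expC s t * expC s' t'.
Proof.
by rewrite /expC expRD cosD sinD; simpc; congr Complex; ring.
Qed.

Lemma expCD2pi s t : expC s (t + pi *+ 2) = expC s t.
Proof. by rewrite /expC cosD2pi sinD2pi. Qed.

Lemma normc_expC s t : normc (expC s t) = expR s.
Proof.
by rewrite /= !exprMn -mulrDr cos2Dsin2 mulr1 sqrtr_sqr ger0_norm.
Qed.

(** Complex differentiability of the exponential at 0, with derivative 1; [expCD] carries it to
    every other point. *)
Lemma expC_derive0 e : 0 < e -> exists2 d, 0 < d & forall s t,
  `|s| < d -> `|t| < d ->
  normc (expC s t - 1 - (Complex s t : C)) <= e * (`|s| + `|t|).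
Proof.
(* The bound 1 yields [|expR s - 1| <= 2 * |s|], hence [A1] and [A2]; the four error terms below add
   up to at most [5 * e' * (|s| + |t|)]. *)
move=> e0; pose e' := Num.min 1 (e / 5).
have e'0 : 0 < e' by rewrite lt_min ltr01 divr_gt0.
have [d1 d10 h1] := @is_derive1_eps R expR 0 _ (is_derive_expR 0) e' e'0.
have [d2 d20 h2] := @is_derive1_eps R cos 0 _ (is_derive_cos 0) e' e'0.
have [d3 d30 h3] := @is_derive1_eps R sin 0 _ (is_derive_sin 0) e' e'0.
exists (Num.min (Num.min d1 (e' / 2)) (Num.min d2 d3)) => [|s t].
  by rewrite !lt_min d10 d20 d30 divr_gt0.
rewrite !lt_min => /andP[/andP[sd1 se] _] /andP[_ /andP[td2 td3]].
have := h1 s; have := h2 t; have := h3 t; rewrite !subr0 => /(_ td3) h3' /(_ td2) h2' /(_ sd1).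
move: h2' h3'; rewrite expR0 sin0 cos0 oppr0 mul0r !mul1r !subr0 addr0 => ct st es.
have e1 : e' <= 1 by rewrite ge_min lexx.
have e5 : e' <= e / 5 by rewrite ge_min lexx orbT.
have s0 := normr_ge0 s; have t0 := normr_ge0 t.
have A1 : `|expR s - 1| <= e' by
  rewrite -(subrK s (expR s - 1)) (le_trans (ler_normD _ _)) //; nra.
have A2 : `|expR s| <= 2 by
  rewrite -(subrK 1 (expR s)) (le_trans (ler_normD _ _)) // normr1; lra.
apply: (le_trans (@normc_le_ReIm R _)) => /=.
have -> : expR s * cos t - 1 - s = (expR s - 1 - s) + expR s * (cos t - 1) by ring.
have -> : expR s * sin t - 0 - t = expR s * (sin t - t) + (expR s - 1) * t by ring.
have B1 : `|expR s * (cos t - 1)| <= 2 * (e' * `|t|) by rewrite normrM ler_pM.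
have B2 : `|expR s * (sin t - t)| <= 2 * (e' * `|t|) by rewrite normrM ler_pM.
have B3 : `|(expR s - 1) * t| <= e' * `|t| by rewrite normrM ler_wpM2r.
have := ler_normD (expR s - 1 - s) (expR s * (cos t - 1)).
have := ler_normD (expR s * (sin t - t)) ((expR s - 1) * t).
have : 5 * e' * (`|s| + `|t|) <= e * (`|s| + `|t|) by
  apply: ler_wpM2r; [exact: addr_ge0 | lra].
have := mulr_ge0 (ltW e'0) s0; have := mulr_ge0 (ltW e'0) t0.
nra.
Qed.

End Exponential.

(** * Discrete Goursat lemma *)

Section DiscreteGoursat.
Variable R : realType.
Local Notation C := (Cplx R).
Implicit Types (x y l t u v e : R) (p q : C) (G : R -> C) (F : R -> R -> C).

(** A left-endpoint Riemann sum; with [2 ^ m] steps, halving the interval and lowering [m] by one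
    keeps the same nodes, so subdivision is an exact identity. *)
Definition dyadic_sum m l G : C :=
  \sum_(i < 2 ^ m) ((l / 2 ^+ m)%:C)%C * G (i%:R * (l / 2 ^+ m)).

Lemma dyadic_sumD m l G G' :
  dyadic_sum m l (fun t => G t + G' t) = dyadic_sum m l G + dyadic_sum m l G'.
Proof. by rewrite -big_split; apply: eq_bigr => i _; rewrite mulrDr. Qed.

Lemma dyadic_sum_const m l (c : C) : dyadic_sum m l (fun=> c) = (l%:C)%C * c.
Proof.
rewrite /dyadic_sum sumr_const card_ord -(mulr_natl (_ * c)) mulrA; congr (_ * _).
have -> : ((2 ^ m)%:R : C) = (((2 ^ m)%:R : R)%:C)%C by rewrite rmorph_nat.
rewrite -rmorphM /=; congr (_%:C)%C.
by rewrite natrX mulrCA divff ?mulr1 // expf_neq0 // pnatr_eq0.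
Qed.

Lemma dyadic_sumS m l G : dyadic_sum m.+1 l G =
  dyadic_sum m (l / 2) G + dyadic_sum m (l / 2) (fun t => G (l / 2 + t)).
Proof.
have n0 : (2 ^+ m : R) != 0 by rewrite expf_neq0 // pnatr_eq0.
have hh : l / 2 ^+ m.+1 = l / 2 / 2 ^+ m by rewrite exprS; field.
rewrite /dyadic_sum hh expnS mul2n -addnn big_split_ord /=; congr (_ + _).
apply: eq_bigr => i _; congr (_ * G _).
by rewrite natrD mulrDl natrX; congr (_ + _); field.
Qed.

Lemma normc_dyadic_sum m l G (B : R) : 0 <= l ->
  (forall t, 0 <= t <= l -> normc (G t) <= B) -> normc (dyadic_sum m l G) <= l * B.
Proof.
move=> l0 GB.
have n0 : 0 < (2 ^+ m : R) by rewrite exprn_gt0.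
have h0 : 0 <= l / 2 ^+ m by rewrite divr_ge0 // ltW.
have : normc (dyadic_sum m l G) <= \sum_(i < 2 ^ m) l / 2 ^+ m * B.
  apply: le_normc_sum => i; rewrite normcM normc_real ger0_norm // ler_wpM2l //.
  apply: GB; rewrite mulr_ge0 //= mulrCA; apply: ler_piMr => //.
  by rewrite ler_pdivrMr // mul1r -natrX ler_nat ltnW.
rewrite sumr_const card_ord -(mulr_natl (_ * B)) natrX mulrA => /le_trans; apply.
by rewrite mulrCA divff ?mulr1 // gt_eqF.
Qed.

(* Left Riemann sum of [F (p dx + q dy)] over the boundary of a square; on
   affine functions [c + D (p x + q y)] it vanishes exactly. *)
Definition contour_sum F p q m x y l : C := dyadic_sum m l (fun t =>
  p * (F (x + t) y - F (x + t) (y + l)) + q * (F (x + l) (y + t) - F x (y + t))).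

(** Each inner edge is shared by two quarters, which traverse it in opposite directions, so its
    contributions cancel exactly. *)
Lemma contour_sumS F p q m x y l : contour_sum F p q m.+1 x y l =
  contour_sum F p q m x y (l / 2) + contour_sum F p q m (x + l / 2) y (l / 2) +
  contour_sum F p q m x (y + l / 2) (l / 2) +
  contour_sum F p q m (x + l / 2) (y + l / 2) (l / 2).
Proof.
have hl z : z + l / 2 + l / 2 = z + l by field.
rewrite /contour_sum dyadic_sumS -!dyadic_sumD; congr dyadic_sum.
apply/funext => t; rewrite !hl !addrA; ring.
Qed.

(** Cauchy-Riemann condition in the coordinate [p * x + q * y]: the differential of [F] is [D] times
    [p dx + q dy]. *)
Definition sum_derivable F p q u v := exists D : C, forall e, 0 < e ->
  exists2 d, 0 < d & forall x y, `|x - u| < d -> `|y - v| < d ->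
    normc (F x y - F u v - D * (p * ((x - u)%:C)%C + q * ((y - v)%:C)%C))
      <= e * (`|x - u| + `|y - v|).

Lemma contour_sum_le F p q m x y l u v e (D : C) : 0 <= l -> 0 <= e ->
  x <= u <= x + l -> y <= v <= y + l ->
  (forall x' y', x <= x' <= x + l -> y <= y' <= y + l ->
    normc (F x' y' - F u v - D * (p * ((x' - u)%:C)%C + q * ((y' - v)%:C)%C))
      <= e * (`|x' - u| + `|y' - v|)) ->
  normc (contour_sum F p q m x y l) <= 4 * (normc p + normc q) * e * l ^+ 2.
Proof.
move=> l0 e0 hu hv hF.
have -> : 4 * (normc p + normc q) * e * l ^+ 2 =
  l * (normc p * (e * (2 * l) + e * (2 * l)) + normc q * (e * (2 * l) + e * (2 * l))).
  by ring.
apply: normc_dyadic_sum => // t ht.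
pose r x' y' : C := F x' y' - F u v - D * (p * ((x' - u)%:C)%C + q * ((y' - v)%:C)%C).
have rB x' y' : x <= x' <= x + l -> y <= y' <= y + l -> normc (r x' y') <= e * (2 * l).
  move=> hx hy; apply: le_trans (hF _ _ hx hy) _; apply: ler_wpM2l => //.
  have : `|x' - u| <= l by rewrite ler_norml; lra.
  have : `|y' - v| <= l by rewrite ler_norml; lra.
  lra.
(* The affine part contributes [- D * p * q * l] from the first difference and [D * p * q * l] from
   the second, so only the remainder [r] survives. *)
have -> : p * (F (x + t) y - F (x + t) (y + l)) + q * (F (x + l) (y + t) - F x (y + t))
  = p * (r (x + t) y - r (x + t) (y + l)) + q * (r (x + l) (y + t) - r x (y + t)).
  by rewrite /r !rmorphB !rmorphD /=; ring.
apply: le_trans (le_normcD _ _) _; rewrite !normcM; apply: lerD.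
  apply: ler_wpM2l; first exact: normc_ge0.
  by apply: (le_trans (@normcB_le R _ _)); apply: lerD; apply: rB; lra.
apply: ler_wpM2l; first exact: normc_ge0.
by apply: (le_trans (@normcB_le R _ _)); apply: lerD; apply: rB; lra.
Qed.

(** The bound is proportional to the area [l ^+ 2], so bounds on four quarters add up to the bound
    on the whole square, and [square_bisection] reduces the claim to small squares. *)
Lemma discrete_goursat F p q : (forall u v, 0 <= u <= 1 -> 0 <= v <= 1 -> sum_derivable F p q u v) ->
  forall e, 0 < e -> exists m, normc (contour_sum F p q m 0 0 1) <= e.
Proof.
move=> dF e e0.
pose A := 4 * (normc p + normc q).
have A0 : 0 <= A by rewrite mulr_ge0 // addr_ge0 // normc_ge0.
have A1 : 0 < A + 1 by lra.
pose e' := e / (A + 1).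
have e'0 : 0 < e' by rewrite divr_gt0.
(* The bound is asked for all large [m], since the four quarters must be treated at one common
   level. *)
pose P x y l := exists m0, forall m, (m0 <= m)%N ->
  normc (contour_sum F p q m x y l) <= A * e' * l ^+ 2.
suff [m hm] : P 0 0 1.
  exists m; apply: le_trans (hm m (leqnn m)) _; rewrite expr1n mulr1.
  by rewrite /e' mulrCA ger_pMr // ler_pdivrMr // mul1r; lra.
apply: square_bisection.
  move=> x y l [m1 h1] [m2 h2] [m3 h3] [m4 h4].
  (* The successor pays for the level lost in [contour_sumS]. *)
  exists (maxn (maxn m1 m2) (maxn m3 m4)).+1 => -[//|m].
  rewrite ltnS !geq_max => /andP[/andP[le1 le2] /andP[le3 le4]].
  rewrite contour_sumS.
  have -> : A * e' * l ^+ 2 = A * e' * (l / 2) ^+ 2 + A * e' * (l / 2) ^+ 2 +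
    A * e' * (l / 2) ^+ 2 + A * e' * (l / 2) ^+ 2 by field.
  do 3 (apply: le_trans (le_normcD _ _) _; apply: lerD; last by auto).
  exact: h1.
move=> u v.
have [/andP[/dF hu /hu]|out] := boolP ((0 <= u <= 1) && (0 <= v <= 1)).
  move=> [D /(_ e' e'0)[d d0 hd]]; exists d => // x y l hl x0 x1 y0 y1 hx hy.
  exists 0%N => m _; apply: (@contour_sum_le _ _ _ _ _ _ _ u v _ D) => //; try lra.
  move=> x' y' hx' hy'; apply: hd; rewrite ltr_norml; lra.
exists 1 => // x y l hl x0 x1 y0 y1 hx hy; case/negP: out.
by apply/andP; split; lra.
Qed.

End DiscreteGoursat.

(** * Maximum principle *)

Section MaximumPrinciple.
Variable R : realType.
Local Notation C := (Cplx R).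
Implicit Types (z w a : C) (f g : C -> C) (M : R).

Lemma sum_derivable_expC g (T u v : R) : 0 < T -> u <= 1 ->
  derivable g (expC (T * (u - 1)) (v * (pi *+ 2))) 1 ->
  sum_derivable (fun x y => g (expC (T * (x - 1)) (y * (pi *+ 2))))
    ((T%:C)%C : C) (Complex 0 (pi *+ 2) : C) u v.
Proof.
move=> T0 u1; set E0 := expC _ _ => /derivable_normc[D hD].
(* Chain rule: the exponential is its own derivative, with value [E0] at the base point. *)
exists (D * E0) => e e0.
have pi0 : 0 < pi *+ 2 :> R by rewrite pmulrn_lgt0 // pi_gt0.
have E01 : normc E0 <= 1.
  rewrite /E0 normc_expC expR_le1.
  by rewrite pmulr_rle0 // subr_le0.
pose L : R := T + pi *+ 2.
have L0 : 0 < L by rewrite addr_gt0.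
have D0 : 0 <= normc D := normc_ge0 D.
have D10 : 0 < normc D + 1 by lra.
have eL0 : 0 < e / L by rewrite divr_gt0.
(* Error budget: [e1 <= 1] gives the factor 2 in [dE], so the expansion of [g] with [e / L / 4]
   costs [e / L / 2]; the other bound on [e1] makes the error of the exponential, multiplied by [D],
   cost as much. The factor [L] converts [|s| + |t|] back to [|x - u| + |y - v|]. *)
pose e1 := Num.min 1 (e / L / (2 * (normc D + 1))).
have e10 : 0 < e1 by rewrite lt_min ltr01 divr_gt0 // mulr_gt0.
have [d1 d10 h1] := @expC_derive0 R e1 e10.
have [|d2 d20 h2] := hD (e / L / 4); first by rewrite divr_gt0.
exists (Num.min d1 (d2 / 4) / L) => [|x y].
  by rewrite divr_gt0 // lt_min d10 divr_gt0.
rewrite !ltr_pdivlMr // => hx hy.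
pose s := T * (x - u); pose t := (y - v) * (pi *+ 2).
have xu0 := normr_ge0 (x - u); have yv0 := normr_ge0 (y - v).
have sE : `|s| = T * `|x - u| by rewrite normrM gtr0_norm.
have tE : `|t| = `|y - v| * (pi *+ 2) by rewrite normrM (gtr0_norm pi0).
have sL : `|s| <= `|x - u| * L by rewrite sE mulrC ler_wpM2l // lerDl ltW.
have tL : `|t| <= `|y - v| * L by rewrite tE ler_wpM2l // lerDr ltW.
have /andP[sd1 sd2] : (`|s| < d1) && (`|s| < d2 / 4).
  by rewrite -lt_min; exact: le_lt_trans sL hx.
have /andP[td1 td2] : (`|t| < d1) && (`|t| < d2 / 4).
  by rewrite -lt_min; exact: le_lt_trans tL hy.
pose eta : C := Complex s t.
have -> : ((T%:C)%C : C) * ((x - u)%:C)%C + (Complex 0 (pi *+ 2) : C) * ((y - v)%:C)%C = eta.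
  by rewrite /eta /s /t; simpc; congr Complex; ring.
have -> : expC (T * (x - 1)) (y * (pi *+ 2)) = E0 * expC s t.
  by rewrite /E0 -expCD; congr expC; rewrite /s /t; ring.
have := h1 s t sd1 td1; set r : C := expC s t - 1 - _ => hr.
have etaN : normc eta <= `|s| + `|t| := @normc_le_ReIm R eta.
have s0 := normr_ge0 s; have t0 := normr_ge0 t.
have e11 : e1 <= 1 by rewrite ge_min lexx.
have De1 : normc D * e1 <= e / L / 2.
  have : e1 <= e / L / (2 * (normc D + 1)) by rewrite ge_min lexx orbT.
  rewrite ler_pdivlMr ?mulr_gt0 //; lra.
have dE : normc (E0 * expC s t - E0) <= 2 * (`|s| + `|t|).
  have -> : E0 * expC s t - E0 = E0 * (eta + r) by rewrite /r /eta; ring.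
  rewrite normcM; apply: le_trans (ler_wpM2r (normc_ge0 _) E01) _; rewrite mul1r.
  apply: le_trans (le_normcD _ _) _; nra.
have {}h2 := h2 (E0 * expC s t).
have {}h2 := h2 (le_lt_trans dE (ltac:(lra) : 2 * (`|s| + `|t|) < d2)).
have -> : g (E0 * expC s t) - g E0 - D * E0 * eta =
   (g (E0 * expC s t) - g E0 - D * (E0 * expC s t - E0)) + D * (E0 * r).
  by rewrite /r /eta; ring.
apply: le_trans (le_normcD _ _) _.
have DE : normc (D * (E0 * r)) <= normc D * (e1 * (`|s| + `|t|)).
  rewrite !normcM ler_wpM2l //.
  apply: le_trans (ler_wpM2r (normc_ge0 _) E01) _; by rewrite mul1r.
have : e / L * (`|s| + `|t|) <= e * (`|x - u| + `|y - v|).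
  rewrite -mulrA ler_wpM2l ?(ltW e0) // mulrC ler_pdivrMr //; lra.
nra.
Qed.

(* In the coordinates [z = expC s t] the two radial sides of the contour cancel
   by periodicity; what is left compares the mean of [g] over the unit circle
   with its mean over the circle of radius [expR (- T)]. *)
Lemma center_le_circle g M : (forall z, normc z <= 1 -> derivable g z 1) ->
  (forall z, normc z = 1 -> normc (g z) <= M) -> normc (g 0) <= M.
Proof.
move=> dg gM; apply/ler_addgt0Pr => e e0.
have e20 : 0 < e / 2 by rewrite divr_gt0.
have [|d d0 hd] := @derivable_normc_continuous R g 0 _ (e / 2) e20.
  by apply: dg; rewrite normc0.
(* As [expR T >= 1 + T > d^-1], the inner circle of radius [expR (- T)] lies where [g] is within
   [e / 2] of [g 0]. *)
pose T := d^-1; have T0 : 0 < T by rewrite invr_gt0.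
have Td : expR (- T) < d.
  rewrite expRN invf_plt ?posrE ?expR_gt0 //.
  by have := expR_ge1Dx T; rewrite -/T; lra.
pose F x y := g (expC (T * (x - 1)) (y * (pi *+ 2))).
pose p : C := (T%:C)%C; pose q : C := Complex 0 (pi *+ 2).
have pi0 : 0 < pi *+ 2 :> R by rewrite pmulrn_lgt0 // pi_gt0.
have q0 : 0 < normc q by rewrite /= expr0n add0r sqrtr_sqr normr_gt0 gt_eqF.
have [|m hm] := @discrete_goursat R F p q _ (normc q * (e / 2)) (mulr_gt0 q0 e20).
  move=> u v hu _; apply: sum_derivable_expC => //; first by lra.
  apply: dg; rewrite normc_expC expR_le1.
  by rewrite pmulr_rle0 // subr_le0; case/andP: hu.
have cE : contour_sum F p q m 0 0 1 = dyadic_sum m 1 (fun t => q * (F 1 t - F 0 t)).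
  congr dyadic_sum; apply/funext => t.
  rewrite !add0r /F -[1 * (pi *+ 2)]add0r mul1r mul0r expCD2pi.
  by rewrite subrr mulr0 add0r.
(* The summand is [F 1 t], bounded by [M], plus [g 0 - F 0 t], bounded by [e / 2]; the contour sum
   accounts for the other [e / 2]. *)
have sE : dyadic_sum m 1 (fun t => q * (g 0 - F 0 t + F 1 t)) =
    q * g 0 + contour_sum F p q m 0 0 1.
  have -> : q * g 0 = dyadic_sum m 1 (fun=> q * g 0) by rewrite dyadic_sum_const mul1r.
  rewrite cE -dyadic_sumD; congr dyadic_sum; apply/funext => t; ring.
have sM : normc (dyadic_sum m 1 (fun t => q * (g 0 - F 0 t + F 1 t))) <=
    1 * (normc q * (e / 2 + M)).
  apply: normc_dyadic_sum => // t _; rewrite normcM ler_wpM2l ?normc_ge0 //.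
  apply: le_trans (le_normcD _ _) _; apply: lerD.
    rewrite -normcN opprB; apply: hd.
    by rewrite subr0 normc_expC sub0r mulrN1.
  by apply: gM; rewrite normc_expC subrr mulr0 expR0.
have : normc (q * g 0) <= normc q * (M + e).
  have -> : q * g 0 = dyadic_sum m 1 (fun t => q * (g 0 - F 0 t + F 1 t)) -
      contour_sum F p q m 0 0 1 by rewrite sE addrK.
  apply: (le_trans (@normcB_le R _ _)).
  by move: sM hm; lra.
by rewrite normcM ler_pM2l.
Qed.

(** * Modulus estimates for the disc automorphisms [Psi] *)

Lemma normc_sqr z : normc z ^+ 2 = complex.Re z ^+ 2 + complex.Im z ^+ 2.
Proof. by case: z => x y /=; rewrite sqr_sqrtr // addr_ge0 ?sqr_ge0. Qed.

Lemma subr_sqr_normc_ge0 z : normc z <= 1 -> 0 <= 1 - normc z ^+ 2.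
Proof. by move=> z1; rewrite subr_ge0 expr_le1 // normc_ge0. Qed.

Lemma subr_sqr_normc_gt0 z : normc z < 1 -> 0 < 1 - normc z ^+ 2.
Proof. by move=> z1; rewrite subr_gt0 expr_lt1 // normc_ge0. Qed.

Lemma Psi_identity a z :
  normc (1 - a^* * z) ^+ 2 - normc (a - z) ^+ 2 =
  (1 - normc a ^+ 2) * (1 - normc z ^+ 2).
Proof.
rewrite !normc_sqr; case: a z => [a1 a2] [z1 z2] /=.
ring.
Qed.

Lemma Psi_den a z : normc a < 1 -> normc z <= 1 -> 1 - a^* * z != 0.
Proof.
move=> a1 z1; apply/eqP => h.
have /eqP : a^* * z = 1 by rewrite -(subrK (a^* * z) 1) h add0r.
move=> /eqP/(congr1 (@normc R)); rewrite normcM normc_conj normc1 => az1.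
by have := ler_piMr (normc_ge0 a) z1; rewrite az1; lra.
Qed.

Lemma normc_Psi_sqr a z : normc a < 1 -> normc z <= 1 ->
  normc (Psi a z) ^+ 2 = 1 - (1 - normc a ^+ 2) * (1 - normc z ^+ 2) / normc (1 - a^* * z) ^+ 2.
Proof.
move=> a1 z1; rewrite /Psi normcM normcV -Psi_identity.
have : normc (1 - a^* * z) != 0.
  by apply: contra (Psi_den a1 z1) => /eqP/eq0_normc ->.
by move=> h; field.
Qed.

Lemma normc_Psi1 a z : normc a < 1 -> normc z = 1 -> normc (Psi a z) = 1.
Proof.
move=> a1 z1; have := @normc_Psi_sqr a z a1; rewrite z1 lexx => /(_ isT).
rewrite expr1n subrr mulr0 mul0r subr0 => /eqP.
by rewrite sqrf_eq1 => /orP[/eqP //|/eqP h]; have := normc_ge0 (Psi a z); lra.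
Qed.

(** The denominator in [normc_Psi_sqr] has modulus at most 2, whence the 4. The bound depends on [z]
    only through its modulus, hence is the same along an orbit of a rotation. *)
Lemma normc_Psi_bound a z : normc a < 1 -> normc z <= 1 ->
  normc (Psi a z) ^+ 2 <= 1 - (1 - normc a ^+ 2) * (1 - normc z ^+ 2) / 4.
Proof.
move=> a1 z1; rewrite normc_Psi_sqr // lerB // ler_wpM2l //.
  by apply: mulr_ge0; [exact/ltW/subr_sqr_normc_gt0 | exact: subr_sqr_normc_ge0].
have d0 : 0 < normc (1 - a^* * z).
  rewrite lt_def normc_ge0 andbT.
  by apply: contra (Psi_den a1 z1) => /eqP/eq0_normc ->.
rewrite lef_pV2 ?posrE ?exprn_gt0 //.
have := @normcB_le R 1 (a^* * z); rewrite normcM normc_conj normc1.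
have := mulr_ile1 (normc_ge0 a) (normc_ge0 z) (ltW a1) z1.
nra.
Qed.

Lemma normc_Psi_le1 a z : normc a < 1 -> normc z <= 1 -> normc (Psi a z) <= 1.
Proof.
move=> a1 z1; have := normc_Psi_bound a1 z1; have := normc_ge0 (Psi a z).
have : 0 <= (1 - normc a ^+ 2) * (1 - normc z ^+ 2).
  by apply: mulr_ge0; [exact/ltW/subr_sqr_normc_gt0 | exact: subr_sqr_normc_ge0].
nra.
Qed.

Lemma normc_Psi_lt1 a z : normc a < 1 -> normc z < 1 -> normc (Psi a z) < 1.
Proof.
move=> a1 z1; have := normc_Psi_bound a1 (ltW z1); have := normc_ge0 (Psi a z).
have : 0 < (1 - normc a ^+ 2) * (1 - normc z ^+ 2).
  by apply: mulr_gt0; exact: subr_sqr_normc_gt0.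
nra.
Qed.

Lemma PsiK a z : normc a < 1 -> normc z <= 1 -> Psi a (Psi a z) = z.
Proof.
move=> a1 z1; have := Psi_den a1 z1; have := Psi_den a1 (ltW a1).
rewrite /Psi; set c := a^* => h1 h2; field; rewrite h2 /=.
by have -> : 1 - c * z - c * (a - z) = 1 - c * a by ring.
Qed.

Lemma derivable_Psi a z : normc a < 1 -> normc z <= 1 -> derivable (Psi a) z 1.
Proof.
by move=> a1 z1; apply: (@derivable1_moebius (R[i])); exact: Psi_den.
Qed.

(** * The maximum principle and boundedness on the closed disc *)

Lemma maximum_principle g M w : (forall z, normc z <= 1 -> derivable g z 1) ->
  (forall z, normc z = 1 -> normc (g z) <= M) -> normc w < 1 -> normc (g w) <= M.
Proof.
move=> dg gM w1.
have -> : w = Psi w 0 by rewrite /Psi subr0 mulr0 subr0 divr1.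
apply: (@center_le_circle (g \o Psi w)) => z z1 /=.
  apply: (@derivable1_comp (R[i])); first exact: derivable_Psi.
  by apply: dg; exact: normc_Psi_le1.
by apply: gM; exact: normc_Psi1.
Qed.

Lemma derivable_bounded f : (forall z, normc z <= 1 -> derivable f z 1) ->
  exists M, forall z, normc z <= 1 -> normc (f z) <= M.
Proof.
move=> df.
(* The map [2 * x - 1] in each coordinate carries the unit square to [[-1, 1]^2], which contains the
   closed disc. *)
pose P x y l := exists M, forall z, 2 * x - 1 <= complex.Re z <= 2 * (x + l) - 1 ->
  2 * y - 1 <= complex.Im z <= 2 * (y + l) - 1 -> normc z <= 1 -> normc (f z) <= M.
suff [M hM] : P 0 0 1.
  exists M => z z1; apply: hM => //.
    have : complex.Re z ^+ 2 <= 1.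
      by have := normc_sqr z; have := sqr_ge0 (complex.Im z); have := normc_ge0 z; nra.
    nra.
  have : complex.Im z ^+ 2 <= 1.
    by have := normc_sqr z; have := sqr_ge0 (complex.Re z); have := normc_ge0 z; nra.
  nra.
apply: square_bisection => [x y l [M1 h1] [M2 h2] [M3 h3] [M4 h4]|u v].
  exists (Num.max (Num.max M1 M2) (Num.max M3 M4)) => z hx hy z1.
  rewrite !le_max.
  have [x2|x2] := leP (complex.Re z) (2 * (x + l / 2) - 1);
  have [y2|y2] := leP (complex.Im z) (2 * (y + l / 2) - 1).
  - by rewrite h1 //; lra.
  - by rewrite h3 ?orbT //; lra.
  - by rewrite h2 ?orbT //; lra.
  - by rewrite h4 ?orbT //; lra.
pose z0 : C := Complex (2 * u - 1) (2 * v - 1).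
have dist x y l z : 0 <= l -> x <= u <= x + l -> y <= v <= y + l ->
    2 * x - 1 <= complex.Re z <= 2 * (x + l) - 1 ->
    2 * y - 1 <= complex.Im z <= 2 * (y + l) - 1 -> normc (z - z0) <= 4 * l.
  move=> l0 hx hy hz1 hz2; apply: (le_trans (@normc_le_ReIm R _)).
  case: z hz1 hz2 => z1 z2 /= hz1 hz2.
  have : `|z1 - (2 * u - 1)| <= 2 * l by rewrite ler_norml; lra.
  have : `|z2 - (2 * v - 1)| <= 2 * l by rewrite ler_norml; lra.
  lra.
have [z01|z01] := leP (normc z0) 1.
  have [d d0 hd] := derivable_normc_continuous (df _ z01) ltr01.
  exists (d / 4) => [|x y l hl _ _ _ _ hx hy]; first by rewrite divr_gt0.
  exists (normc (f z0) + 1) => z hz1 hz2 _.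
  rewrite -(subrK (f z0) (f z)); apply: le_trans (le_normcD _ _) _.
  rewrite addrC lerD2l; apply: hd.
  have := dist x y l z; rewrite hx hy hz1 hz2 => /(_ _ isT isT isT isT) h.
  by apply: le_lt_trans (h _) _; lra.
(* If [z0] is outside the closed disc, squares this small miss the disc, because their points are
   within [4 * l] of [z0]. *)
exists ((normc z0 - 1) / 4) => [|x y l hl _ _ _ _ hx hy].
  by rewrite divr_gt0 // subr_gt0.
exists 0 => z hz1 hz2 z1; exfalso.
have := dist x y l z; rewrite hx hy hz1 hz2 => /(_ _ isT isT isT isT) h.
have {}h : normc (z - z0) <= 4 * l by apply: h; lra.
have := @normcB_le R z (z - z0); rewrite opprB addrC subrK.
lra.
Qed.

End MaximumPrinciple.

(** * Weighted rotations *)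

Section WeightedRotation.
Variable R : realType.
Local Notation C := (Cplx R).
Implicit Types (z w p b lam : C) (f h k m : C -> C).

Definition derivable_cdisc f := forall z, normc z <= 1 -> derivable f z 1.

Lemma normc_rotX b z n : normc b = 1 -> normc (b ^+ n * z) = normc z.
Proof. by move=> b1; rewrite normcM normcX b1 expr1n mul1r. Qed.

Lemma derivable_cdisc_rotX f b n : normc b = 1 -> derivable_cdisc f ->
  derivable_cdisc (fun z => f (b ^+ n * z)).
Proof.
move=> b1 df z z1; apply: (@derivable1_comp (R[i]) (fun x => b ^+ n * x) f).
  exact: derivable1_lin.
by apply: df; rewrite normc_rotX.
Qed.

Lemma Psi_eq0 w z : normc w < 1 -> normc z <= 1 -> (Psi w z == 0) = (z == w).
Proof.
move=> w1 z1; rewrite /Psi mulf_eq0 invr_eq0 (negPf (Psi_den w1 z1)) orbF.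
by rewrite subr_eq0 eq_sym.
Qed.

(** The quotients [F n] are left abstract to serve zero and nonzero eigenvalues alike; [b = 1] gives
    the powers of a single factor. The square of [f] matches the quotient [m ^+ 2 / Psi w] used for
    nonzero eigenvalues. *)
Lemma eq0_of_Psi_divisible f w b (F : nat -> C -> C) p :
  normc w < 1 -> normc b = 1 -> derivable_cdisc f ->
  (forall n, derivable_cdisc (F n)) ->
  (forall n z, normc z <= 1 ->
    f z ^+ 2 = F n z * \prod_(j < n) Psi w (b ^+ j * z)) ->
  normc p < 1 -> f p = 0.
Proof.
move=> w1 b1 df dF fF p1; apply/eqP; apply: contraT => fp.
have [M fM] := derivable_bounded df.
have fp0 : 0 < normc (f p).
  by rewrite lt_def normc_ge0 andbT; apply: contra fp => /eqP/eq0_normc ->.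
pose rho := 1 - (1 - normc w ^+ 2) * (1 - normc p ^+ 2) / 4.
have rho1 : rho < 1.
  rewrite /rho ltrBlDr ltrDl divr_gt0 // mulr_gt0 //; exact: subr_sqr_normc_gt0.
have rho0 : 0 <= rho.
  by apply: le_trans (normc_Psi_bound w1 (ltW p1)); exact: sqr_ge0.
have Fp n : normc (F n p) <= M ^+ 2.
  apply: (maximum_principle (dF n)) => // z z1.
  have zle : normc z <= 1 by rewrite z1.
  have /(congr1 (@normc R)) := fF n z zle; rewrite normcX normcM normc_prod.
  rewrite big1 ?mulr1 => [<-|j _]; last by rewrite normc_Psi1 // normc_rotX.
  have fz := normc_ge0 (f z).
  by rewrite lerXn2r ?nnegrE ?(le_trans fz) ?fM.
(* Squaring once more, since [rho] bounds the square of the modulus of each factor. *)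
have fpM n : normc (f p) ^+ 4 <= (M ^+ 2) ^+ 2 * rho ^+ n.
  have /(congr1 (@normc R)) := fF n p (ltW p1); rewrite normcX normcM normc_prod.
  move=> /(congr1 (fun x => x ^+ 2)); rewrite -exprM => ->.
  rewrite exprMn ler_pM ?sqr_ge0 //.
    by rewrite lerXn2r ?nnegrE ?normc_ge0 // sqr_ge0.
  rewrite -prodrXl -[n in rho ^+ n]card_ord -prodr_const ler_prod // => j _.
  rewrite sqr_ge0 /= /rho -(normc_rotX p j b1) normc_Psi_bound //.
  by rewrite normc_rotX // ltW.
have e0 : 0 < normc (f p) ^+ 4 / ((M ^+ 2) ^+ 2 + 1).
  by rewrite divr_gt0 ?exprn_gt0 // ltr_pwDr // sqr_ge0.
have /cvgrPdist_lt/(_ _ e0)[n _ /(_ n (leqnn n))] :=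
    @cvg_expr R rho (ltac:(by rewrite ger0_norm)).
rewrite sub0r normrN ger0_norm ?exprn_ge0 // ltr_pdivlMr; last first.
  by rewrite ltr_pwDr // sqr_ge0.
have := fpM n; have : 0 <= rho ^+ n by rewrite exprn_ge0.
lra.
Qed.

Lemma eigenvector_eq0 h m b w lam p : lam != 0 ->
  normc b = 1 -> normc w < 1 -> m w = 0 ->
  derivable_cdisc h -> derivable_cdisc m ->
  (forall z, normc z <= 1 -> lam * h z = m z * h (b * z)) ->
  normc p < 1 -> h p = 0.
Proof.
move=> lam0 b1 w1 mw dh dm eig.
(* [m / Psi w] would require removing a singularity at [w]; [m ^+ 2 / Psi w]
   is differentiable there by [derivable1_sq_div]. *)
pose Q z : C := m z ^+ 2 / (w - z) * (1 - w^* * z).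
have QE z : normc z <= 1 -> Q z * Psi w z = m z ^+ 2.
  move=> z1; have [->|zw] := eqVneq z w.
    by rewrite /Q /Psi subrr mul0r mulr0 mw expr0n.
  have := Psi_den w1 z1; rewrite /Q /Psi; set c := w^* => h1.
  by field; rewrite h1 subr_eq0 eq_sym zw.
have dQ : derivable_cdisc Q.
  move=> z z1; apply: (@derivable1_mul (R[i])); last first.
    exact: (@derivable1_affine (R[i])).
  have [->|zw] := eqVneq z w.
    by apply: (@derivable1_sq_div (R[i])) => //; apply: dm; exact: ltW.
  apply: (@derivable1_div (R[i])).
  - by apply: (@derivable1_exp (R[i])); exact: dm.
  - by under eq_fun do rewrite -[X in w - X]mul1r; exact: (@derivable1_affine (R[i])).
  - by rewrite subr_eq0 eq_sym.
(* Iterate [h z = lam^-1 * m z * h (b * z)] [n] times, square, and remove [Psi w] from each factor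
   [m ^+ 2 = Q * Psi w]. *)
pose F n z : C := (lam ^- 2) ^+ n * \prod_(j < n) Q (b ^+ j * z) * h (b ^+ n * z) ^+ 2.
move=> p1; apply: (@eq0_of_Psi_divisible h w b F p w1 b1 dh _ _ p1) => n z z1.
  apply: (@derivable1_mul (R[i])); last first.
    by apply: (@derivable1_exp (R[i])); exact: derivable_cdisc_rotX.
  apply: (@derivable1_mul (R[i])); first exact: derivable_cst.
  by apply: (@derivable1_prod (R[i])) => i; exact: derivable_cdisc_rotX.
rewrite /F; elim: n => [|n IHn]; first by rewrite !big_ord0 !expr0 !mul1r mulr1.
rewrite IHn !big_ord_recr /=.
have y1 : normc (b ^+ n * z) <= 1 by rewrite normc_rotX.
have hy : h (b ^+ n * z) ^+ 2 =
    lam ^- 2 * (Q (b ^+ n * z) * Psi w (b ^+ n * z)) * h (b ^+ n.+1 * z) ^+ 2.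
  rewrite QE // -mulrA -exprMn (exprS b) -(mulrA b) -eig //.
  by rewrite exprMn mulrA mulVf ?mul1r // expf_neq0.
rewrite hy (exprSr (lam ^- 2)); set A := (lam ^- 2) ^+ n; set B := lam ^- 2.
by set P := \prod_(i < n) _; set P' := \prod_(i < n) _; ring.
Qed.

Lemma rotation_mul_eq0 h m b w p : normc b = 1 -> normc w < 1 -> m w != 0 ->
  derivable_cdisc h -> derivable_cdisc m ->
  (forall z, normc z <= 1 -> m z * h (b * z) = 0) ->
  normc p < 1 -> h p = 0.
Proof.
move=> b1 w1 mw dh dm mh p1.
pose k z := h (b * z).
have dk : derivable_cdisc k := (derivable_cdisc_rotX (n := 1) b1 dh).
(* By continuity [m] has no zero near [w], so there the other factor must vanish. *)
have [d d0 kd] : exists2 d, 0 < d & forall z, normc (z - w) < d -> k z = 0.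
  have mw0 : 0 < normc (m w).
    by rewrite lt_def normc_ge0 andbT; apply: contra mw => /eqP/eq0_normc ->.
  have e0 : 0 < normc (m w) / 2 by rewrite divr_gt0.
  have [d d0 hd] := derivable_normc_continuous (dm _ (ltW w1)) e0.
  exists (Num.min d (1 - normc w)) => [|z]; first by rewrite lt_min d0 subr_gt0.
  rewrite lt_min => /andP[/hd mz zw].
  have z1 : normc z <= 1.
    by have := le_normcD (z - w) w; rewrite subrK; lra.
  have /eqP := mh z z1; rewrite mulf_eq0 => /orP[/eqP mz0|/eqP //].
  by exfalso; move: mz; rewrite {}mz0 sub0r normcN; lra.
have kp z : normc z < 1 -> k z = 0.
  (* With rotation 1 the product is [Psi w z ^+ n]. The quotient is differentiable at [w] because
     its numerator vanishes on a whole neighbourhood. *)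
  apply: (@eq0_of_Psi_divisible k w 1 (fun n z => k z ^+ 2 / Psi w z ^+ n) z w1
    (normc1 R) dk) => n x x1.
  - have [xw|xw] := eqVneq x w.
      apply: (@derivable1_eq_nbhs (R[i]) (cst 0) _ _ (d%:C)%C); last exact: derivable_cst.
        by rewrite ltcR.
      move=> y; rewrite xw => yw.
      have /kd -> : normc (y - w) < d by rewrite -ltcR.
      by rewrite expr0n mul0r.
    apply: (@derivable1_div (R[i])).
    + by apply: (@derivable1_exp (R[i])); exact: dk.
    + by apply: (@derivable1_exp (R[i])); exact: derivable_Psi.
    + by rewrite expf_neq0 // Psi_eq0.
  - under eq_bigr do rewrite expr1n mul1r.
    rewrite prodr_const card_ord; have [->|xw] := eqVneq x w.
      by rewrite kd ?expr0n ?mul0r // subrr normc0.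
    by rewrite divfK // expf_neq0 // Psi_eq0.
have b0 : b != 0 by apply/eqP => b0; move: b1; rewrite b0 normc0 => /esym/eqP; rewrite oner_eq0.
have := kp (b^-1 * p); rewrite /k mulrA divff // mul1r; apply.
by rewrite normcM normcV b1 invr1 mul1r.
Qed.

End WeightedRotation.

(** * Reduction of the theorem to weighted rotations *)

Unset Implicit Arguments. Set Strict Implicit.

Theorem theorem8p2 (R : realType) (alpha beta : Cplx R)
  (m : Cplx R -> Cplx R) :
  alpha \in disc R ->
  `|beta| = 1 -> beta != 1 ->
  holo_disc m ->
  (exists2 z, z \in disc R & m z != 0) ->
  (exists2 z0, z0 \in disc R & m z0 = 0) ->
  point_spectrum (wcomp m (phi_ab alpha beta)) = set0.
Proof.
have discE (z : Cplx R) : (z \in disc R) = (normc z < 1).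
  by rewrite -normc_lt1; apply/idP/idP; rewrite in_setE.
rewrite discE => a1 /(congr1 (@complex.Re R)) b1 _ dm [z1 +] mz1 [z0 +] mz0.
rewrite !discE => z1D z0D.
apply/seteqP; split=> // lam [f [g [df dg [z +] fgz eig]]].
rewrite discE => zD; case/negP: fgz; rewrite -subr_eq0; apply/eqP.
pose psi := Psi alpha.
have psiD x : normc x < 1 -> normc (psi x) < 1 by exact: normc_Psi_lt1.
(* A radius [r] strictly between [s] and 1 leaves room on both sides: the three points remain inside
   after division by [r], and the closed unit disc scaled by [r] stays inside the open disc. *)
pose s := Num.max (normc (psi z)) (Num.max (normc (psi z0)) (normc (psi z1))).
have s1 : s < 1 by rewrite !gt_max !psiD.
have := lexx s; rewrite {1}/s !ge_max => /andP[ps /andP[p0s p1s]].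
pose r := (1 + s) / 2.
have r1 : r < 1 by rewrite /r; lra.
have pr : normc (psi z) < r by rewrite /r; lra.
have p0r : normc (psi z0) < r by rewrite /r; lra.
have p1r : normc (psi z1) < r by rewrite /r; lra.
have r0 : 0 < r by apply: le_lt_trans pr; exact: normc_ge0.
pose rC : Cplx R := (r%:C)%C.
have rC0 : rC != 0 by rewrite /rC -(rmorph0 (real_complex R)) (inj_eq (@complexI _)) gt_eqF.
have rCN : normc rC = r by rewrite normc_real gtr0_norm.
have rD x : normc x <= 1 -> normc (rC * x) < 1.
  by move=> x1; rewrite normcM rCN; apply: le_lt_trans r1; rewrite ger_pMr.
have rV x : normc x < r -> normc (rC^-1 * x) < 1.
  by move=> xr; rewrite normcM normcV rCN mulrC ltr_pdivrMr // mul1r.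
have rKx u (x : Cplx R) : normc x < 1 -> u (psi (rC * (rC^-1 * psi x))) = u x :> Cplx R.
  by move=> x1; rewrite mulrA divff // mul1r /psi PsiK // ltW.
pose pull (u : Cplx R -> Cplx R) x := u (psi (rC * x)).
have dpull u : holo_disc u -> derivable_cdisc (pull u).
  move=> du x x1; apply: (@derivable1_comp (R[i]) (fun x => psi (rC * x)) u).
    apply: (@derivable1_comp (R[i]) (fun x => rC * x) psi).
      exact: derivable1_lin.
    by apply: derivable_Psi => //; exact/ltW/rD.
  by apply: du; rewrite discE; exact/psiD/rD.
pose h x := f x - g x.
have dh : holo_disc h by move=> x xD; apply: derivableB; [exact: df | exact: dg].
have eqn x : normc x <= 1 -> lam * pull h x = pull m x * pull h (beta * x).
  move=> x1; have yD := rD _ x1.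
  have := eig (psi (rC * x)); rewrite discE => /(_ (psiD _ yD)).
  (* As [psi] is an involution, it conjugates the symbol to the rotation by [beta], which commutes
     with scaling by [rC]. *)
  rewrite /wcomp /phi_ab /= /Defs.rot [Psi alpha (psi _)]PsiK ?(ltW yD) //.
  rewrite (mulrCA beta) -/psi => e.
  move/eqP: e; rewrite -subr_eq0 => /eqP e.
  by apply/eqP; rewrite -subr_eq0 -[X in _ == X]e /pull /h; apply/eqP; ring.
rewrite -/(h z) -(rKx h z) // -/(pull h _).
have [lam0|lam0] := eqVneq lam 0.
  apply: (@rotation_mul_eq0 R _ (pull m) beta (rC^-1 * psi z1)) => //.
  - exact: rV.
  - by rewrite /pull rKx.
  - exact: dpull.
  - exact: dpull.
  - by move=> x x1; rewrite -eqn // lam0 mul0r.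
  - exact: rV.
apply: (@eigenvector_eq0 R _ (pull m) beta (rC^-1 * psi z0) lam) => //.
- exact: rV.
- by rewrite /pull rKx.
- exact: dpull.
- exact: dpull.
- exact: rV.
Qed.
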